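(* Let $K$ be a totally real number field with ring of integers $\mathcal{O}_K$ and discriminant $\Delta$. For every element $\alpha\in\mathcal{O}_K^+$ with $\mathrm{N}_{K/\mathbb{Q}}(\alpha)>\Delta$ there is a nonzero $\beta\in\mathcal{O}_K$ such that $\alpha\succ\beta^2$. In particular, no such element $\alpha$ is indecomposable.
   Context: An element $\gamma\in K$ is totally positive if $\sigma(\gamma)>0$ for every embedding $\sigma:K\hookrightarrow\mathbb{R}$; $\mathcal{O}_K^+$ is the set of totally positive elements of $\mathcal{O}_K$. For $\alpha,\beta\in K$, $\alpha\succ\beta$ means that $\alpha-\beta$ is totally positive. $\mathrm{N}_{K/\mathbb{Q}}$ is the field norm. An element $\alpha\in\mathcal{O}_K^+$ is indecomposable if there does not exist $\beta\in\mathcal{O}_K^+$ such that $\alpha\succ\beta$. *)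

(* Defs.v *)
From HB Require Import structures.
From mathcomp Require Import all_boot all_order all_algebra all_field.
From mathcomp Require Import classical_sets reals complex.
Set Implicit Arguments.
Unset Strict Implicit.
Unset Printing Implicit Defensive.
Import Order.TTheory GRing.Theory Num.Theory.
Local Open Scope ring_scope.

(* A number field is a K : fieldExtType rat, i.e. a finite extension of Q.
   Its embeddings into a field F are the ring morphisms {rmorphism K -> F},
   which are automatically injective and Q-linear. *)

Section NumberField.
Variable K : fieldExtType rat.
Implicit Types (a x : K).

Definition alg_integer x : Prop := integralOver (intr : int -> K) x.

Definition mul_mx a : 'M[rat]_(\dim {:K}) :=
  passmx.mxof (vbasis {:K}) (vbasis {:K}) (amulr a).

Definition fnorm a : rat := \det (mul_mx a).

Definition ftrace a : rat := \tr (mul_mx a).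

Definition is_integral_basis (w : (\dim {:K}).-tuple K) : Prop :=
  basis_of {:K} w /\
  forall x, alg_integer x <->
    exists c : 'I_(\dim {:K}) -> int, x = \sum_i (c i)%:~R * tnth w i.

(* The default value vbasis is never selected: every number field has an
   integral basis. *)
Definition integral_basis : (\dim {:K}).-tuple K :=
  xget (vbasis {:K}) is_integral_basis.

(* Does not depend on which integral basis is chosen: two of them differ by a
   matrix of determinant 1 or -1. *)
Definition disc : rat :=
  \det (\matrix_(i < \dim {:K}, j < \dim {:K})
          ftrace (tnth integral_basis i * tnth integral_basis j)).

End NumberField.

Section Positivity.
Variables (R : realType) (K : fieldExtType rat).
Implicit Types (a b : K).

Definition totally_real : Prop :=
  forall (s : {rmorphism K -> R[i]}) (x : K), complex.Im (s x) = 0.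

Definition totally_positive a : Prop :=
  forall s : {rmorphism K -> R}, 0 < s a.

Definition tot_gt a b : Prop := totally_positive (a - b).

Definition tp_integer a : Prop := alg_integer a /\ totally_positive a.

Definition indecomposable a : Prop :=
  tp_integer a /\ ~ exists b : K, tp_integer b /\ tot_gt a b.

End Positivity.

Arguments disc : clear implicits.
Arguments totally_real : clear implicits.
Arguments totally_positive R {K} a.
Arguments tot_gt R {K} a b.
Arguments tp_integer R {K} a.
Arguments indecomposable R {K} a.

(* Main.v *)
From HB Require Import structures.
Require Import Defs.
From mathcomp Require Import all_boot all_order all_algebra all_field.
From mathcomp Require Import zify lra.
From mathcomp Require Import boolp classical_sets reals complex topology normedtype.
Set Implicit Arguments.
Unset Strict Implicit.
Unset Printing Implicit Defensive.
Import Order.TTheory GRing.Theory Num.Theory numFieldNormedType.Exports.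
Local Open Scope ring_scope.

(** The theorem is Minkowski's theorem on linear forms, applied to the ring of
    integers.  Let n be the degree of K and s_1, ..., s_n its embeddings, all of
    them real, and let w be an integral basis.  Then disc K = (det W)^2 for the
    matrix W = (s_j (w_i)), and the norm of alpha is the product of the positive
    numbers s_j alpha.  So the hypothesis disc K < N(alpha) says exactly that
    |det W| is less than the product of the sqrt (s_j alpha), and Minkowski's
    theorem gives a nonzero integral combination beta of w with
    |s_j beta| < sqrt (s_j alpha) for every j.  Squaring, beta^2 is dominated by
    alpha in every embedding.  As beta^2 is itself a totally positive integer,
    alpha is not indecomposable.

    Minkowski's theorem is proved without volumes.  For an integer matrix A the
    group Z^n / A Z^n has |det A| elements, which the Smith normal form makes
    explicit; if a box contains more integer points than that, two of them are
    congruent modulo A Z^n, and their difference is the value of A at a nonzero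
    integer vector ([minkowski_linear_forms_int]).  A real matrix A is
    approximated by the integer matrices floor (N A): [minkowski_linear_forms].

    The arithmetic input has three parts.  The roots of the minimal polynomial
    of a primitive element produce n embeddings into an algebraically closed
    field such as R[i] or algC, and no others exist ([all_embeddings]); when K is totally real they
    take values in R ([real_embeddings]).  The matrix W conjugates
    multiplication by a to the diagonal matrix of the s_j a, whence the formulas
    for norm, trace and discriminant.  Finally an integral basis exists: a basis
    of K made of integers whose discriminant has the least absolute value is one
    ([integral_basis_exists]). *)

(** * Minkowski's theorem on linear forms over the integers *)

Lemma norm_int_unitmx_det n (U : 'M[int]_n) : U \in unitmx -> `|\det U| = 1.
Proof.
rewrite unitmxE => /unitrP[V [VU _]].
have: (`|\det U| * `|V|)%N = 1%N by rewrite -abszM mulrC VU.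
by move/eqP; rewrite muln_eq1 => /andP[/eqP U1 _]; rewrite -abszE U1.
Qed.

Lemma int_smith_diag n (A : 'M[int]_n) :
  exists L U : 'M[int]_n, exists d : 'rV[int]_n,
  [/\ L \in unitmx, U \in unitmx & A = L *m diag_mx d *m U].
Proof.
have [L uL [U uU [d _ defA]]] := int_Smith_normal_form A.
exists L, U, (\row_i d`_i); split=> //; rewrite {1}defA.
by congr (_ *m _ *m _); apply/matrixP=> i j; rewrite !mxE.
Qed.

(** Writing A = L D U by the Smith normal form, a vector v lies in A Z^n if and
    only if each entry of L^-1 v is divisible by the matching entry of D.  The
    residues of L^-1 v therefore sort the integer points of the box into
    |det A| classes, fewer than there are points. *)
Lemma minkowski_linear_forms_int n (A : 'M[int]_n) (c : 'I_n -> nat) :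
  \det A != 0 -> `|\det A| < \prod_i (c i)%:Z ->
  exists2 x : 'cV[int]_n, x != 0 & forall i, `|(A *m x) i 0| < (c i)%:Z.
Proof.
have [L [U [d [uL uU defA]]]] := int_smith_diag A.
have detA : `|\det A| = \prod_i `|d 0 i|.
  rewrite defA !det_mulmx !normrM !(norm_int_unitmx_det uL, norm_int_unitmx_det uU).
  rewrite mul1r mulr1.
  by rewrite det_diag normr_prod.
rewrite -normr_gt0 detA => d_gt0 lt_d_c.
have d_neq0 i : d 0 i != 0.
  move: d_gt0; rewrite lt_def => /andP[/prodf_neq0 d_neq0 _].
  by rewrite -normr_eq0 d_neq0.
pose box := {dffun forall i : 'I_n, 'I_(c i)}.
pose cls := {dffun forall i : 'I_n, 'I_`|d 0 i|}.
pose vec (v : box) : 'cV[int]_n := \col_i (v i)%:Z.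
have cls_lt (v : box) i :
    (absz (modz ((invmx L *m vec v) i 0%R) (d 0%R i)) < absz (d 0%R i))%N.
  by rewrite -ltz_nat !abszE ger0_norm ?modz_ge0 ?ltz_mod.
pose f (v : box) : cls := [ffun i => Ordinal (cls_lt v i)].
have /injectivePn[v [w neq_vw eq_fvw]] : ~~ injectiveb f.
  apply/negP=> /injectiveP/leq_card; apply/negP; rewrite -ltnNge.
  rewrite !card_dep_ffun !foldrE !big_image/=.
  under eq_bigr do rewrite card_ord.
  under [X in (_ < X)%N]eq_bigr do rewrite card_ord.
  rewrite -ltz_nat !(big_morph Posz PoszM (erefl _)).
  by under eq_bigr do rewrite abszE.
pose u : 'cV[int]_n := \col_i ((invmx L *m (vec v - vec w)) i 0%R %/ d 0%R i)%Z.
have def_u : diag_mx d *m u = invmx L *m (vec v - vec w).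
  apply/colP=> i; rewrite mul_diag_mx 2!mxE mulrC divzK //.
  rewrite mulmxBr [X in (_ %| X)%Z]mxE [X in (_ %| _ + X)%Z]mxE -eqz_mod_dvd.
  have /ffunP/(_ i)/(congr1 (fun k => (nat_of_ord k)%:Z)) := eq_fvw.
  by rewrite !ffunE /= !abszE !ger0_norm ?modz_ge0 // => ->.
(* A sends U^-1 u to v - w, since U and L cancel. *)
exists (invmx U *m u).
  apply: contraNneq neq_vw => /(congr1 (mulmx A)).
  rewrite mulmx0 defA mulmxA mulmxK // -mulmxA def_u mulKVmx // => /eqP.
  rewrite subr_eq0 => /eqP/colP eq_vw; apply/eqP/ffunP=> i; apply: val_inj.
  by have := eq_vw i; rewrite !mxE => - [].
move=> i; rewrite defA mulmxA mulmxK // -mulmxA def_u mulKVmx // !mxE.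
rewrite ltr_norml; have := ltn_ord (v i); have := ltn_ord (w i).
move: (nat_of_ord (v i)) (nat_of_ord (w i)) => vi wi; lia.
Qed.

(** * Minkowski's theorem on linear forms over the reals *)

Section RealLinearForms.
Local Open Scope classical_set_scope.

Lemma cvg_ratio_bounded (R : archiRealFieldType) (u : nat -> R) (a k : R) :
  (forall N, `|u N - N%:R * a| <= k) -> N%:R^-1 * u N @[N --> \oo] --> a.
Proof.
move=> u_a; apply/cvgrPdist_lt => e e_gt0.
have k_ge0 : 0 <= k by apply: le_trans (normr_ge0 _) (u_a 0%N).
apply: filterS (nbhs_infty_gtr (k / e)) => N ltN.
have N_gt0 : 0 < N%:R :> R by apply: le_lt_trans ltN; rewrite divr_ge0 // ltW.
rewrite distrC -(ltr_pM2l N_gt0) -{1}[N%:R]gtr0_norm // -normrM mulrBr mulVKf ?gt_eqF //.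
by rewrite (le_lt_trans (u_a N)) // -ltr_pdivrMr.
Qed.

Lemma cvg_det (R : numFieldType) n (T : Type) (F : set_system T) (FF : Filter F)
    (A : T -> 'M[R]_n) (B : 'M[R]_n) :
  (forall i j, A x i j @[x --> F] --> B i j) -> \det (A x) @[x --> F] --> \det B.
Proof.
move=> cvgA; rewrite /determinant; apply: cvg_big => [|s _]; first exact: add_continuous.
apply: cvgM; first exact: cvg_cst.
by apply: cvg_big => [|i _]; [exact: mul_continuous | exact: cvgA].
Qed.

(** The integer theorem is applied to floor (N A) and to the integer bounds
    trunc (N c_i) - K.  After division by N these tend to A and c, so the
    determinant condition holds for large N.  The solution x may depend on N,
    but A is invertible, so its size X stays below a bound 2 S independent of N.
    Replacing floor (N A) by N A costs at most X, which the constant K,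
    chosen above 2 S in advance, absorbs: the strict inequalities survive
    without a compactness argument. *)
Lemma minkowski_linear_forms (R : archiRealFieldType) n (A : 'M[R]_n) (c : 'I_n -> R) :
  (forall i, 0 < c i) -> \det A != 0 -> `|\det A| < \prod_i c i ->
  exists2 x : 'cV[int]_n, x != 0 &
    forall i, `|(A *m map_mx intr x) i 0| < c i.
Proof.
move=> c_gt0 detA_neq0 detA_lt.
have uA : A \in unitmx by rewrite unitmxE unitfE.
pose T := \sum_j \sum_i `|invmx A j i|.
pose S := \sum_j \sum_i `|invmx A j i| * c i.
pose K := (Num.trunc (2 * S)).+1.
have S_ge0 : 0 <= S.
  by apply: sumr_ge0 => j _; apply: sumr_ge0 => i _; rewrite mulr_ge0 // ltW.
have K_gt : 2 * S < K%:R by rewrite truncnS_gt.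
pose B (N : nat) : 'M[int]_n := \matrix_(i, j) Num.floor (N%:R * A i j).
pose m (N : nat) i : nat := (Num.trunc (N%:R * c i) - K)%N.
pose BR N : 'M[R]_n := N%:R^-1 *: map_mx intr (B N).
have B_near N i j : `|(B N i j)%:~R - N%:R * A i j| <= 1.
  rewrite mxE distrC; have /andP[ge lt] := floor_itv (N%:R * A i j).
  by rewrite ger0_norm ?subr_ge0 // lerBlDl -[1]/(1%:~R) -intrD ltW.
have m_near N i : `|(m N i)%:R - N%:R * c i| <= K.+1%:R.
  have Nc_ge0 : 0 <= N%:R * c i by rewrite mulr_ge0 // ltW.
  have /andP[ge lt] := truncn_itv Nc_ge0.
  rewrite ler_distl; apply/andP; split.
    rewrite lerBlDr (le_trans (ltW lt)) // -natrD ler_nat /m; lia.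
  rewrite (@le_trans _ _ (N%:R * c i)) ?lerDl //.
  by rewrite (le_trans _ ge) // ler_nat leq_subr.
have cvgBR : \det (BR N) @[N --> \oo] --> \det A.
  apply: cvg_det => i j; under eq_cvg do rewrite mxE [X in _ * X]mxE.
  exact: cvg_ratio_bounded (fun N => B_near N i j).
have cvgm : \prod_i (N%:R^-1 * (m N i)%:R) @[N --> \oo] --> \prod_i c i.
  apply: cvg_big => [|i _]; first exact: mul_continuous.
  exact: cvg_ratio_bounded (fun N => m_near N i).
have cvg_diff : \prod_i (N%:R^-1 * (m N i)%:R) - `|\det (BR N)| @[N --> \oo]
    --> \prod_i c i - `|\det A|.
  by apply: cvgB cvgm _; apply: cvg_norm.
have ev_neq0 : \forall N \near \oo, \det (BR N) != 0.
  exact: cvgr_neq0 _ cvgBR detA_neq0.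
have ev_lt : \forall N \near \oo,
    0 < \prod_i (N%:R^-1 * (m N i)%:R) - `|\det (BR N)|.
  by apply: cvgr_gt cvg_diff _ _; rewrite subr_gt0.
have [N [[detN_neq0 detN_lt] N_gt]] := filter_ex (filterI (filterI
  ev_neq0 ev_lt) (nbhs_infty_gtr (2 * T))).
have T_ge0 : 0 <= T by apply: sumr_ge0 => j _; apply: sumr_ge0.
have N_gt0 : 0 < N%:R :> R by apply: le_lt_trans N_gt; rewrite mulr_ge0.
have detBR : \det (BR N) = N%:R ^- n * (\det (B N))%:~R.
  by rewrite detZ det_map_mx exprVn.
have [x x_neq0 Bx_lt] : exists2 x : 'cV[int]_n, x != 0 &
    forall i, `|(B N *m x) i 0| < (m N i)%:Z.
  apply: minkowski_linear_forms_int.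
    by apply: contraNneq detN_neq0 => B0; rewrite detBR B0 mulr0.
  move: detN_lt; rewrite subr_gt0 big_split /= prodr_const card_ord detBR.
  rewrite normrM exprVn ger0_norm ?invr_ge0 ?exprn_ge0 ?ler0n //.
  rewrite ltr_pM2l ?invr_gt0 ?exprn_gt0 // -intr_norm.
  by rewrite -(ltr_int R) rmorph_prod.
exists x => // i.
set y := map_mx intr x.
pose X := \sum_j `|y j 0|.
have X_ge0 : 0 <= X by apply: sumr_ge0.
have Ay_near k : `|(A *m y) k 0 - N%:R^-1 * ((B N *m x) k 0)%:~R| <= N%:R^-1 * X.
  have -> : ((B N *m x) k 0)%:~R = (map_mx intr (B N) *m y) k 0 :> R.
    by rewrite -map_mxM [RHS]mxE.
  rewrite -(ler_pM2l N_gt0) mulVKf ?gt_eqF // -{1}[N%:R]gtr0_norm // -normrM.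
  rewrite mulrBr mulVKf ?gt_eqF // distrC !mxE mulr_sumr -sumrB.
  apply: le_trans (ler_norm_sum _ _ _) _; apply: ler_sum => j _.
  by rewrite mulrA -mulrBl normrM ler_piMl // mxE B_near.
have Bx_le k : N%:R^-1 * `|((B N *m x) k 0)%:~R| < c k - N%:R^-1 * K%:R.
  rewrite -(ltr_pM2l N_gt0) mulrBr !mulVKf ?gt_eqF //.
  (* Positivity excludes truncation in m N k = trunc (N c_k) - K. *)
  have m_gt0 : (0 < m N k)%N by have := Bx_lt k; lia.
  have /andP[tr_le _] := truncn_itv (mulr_ge0 (ltW N_gt0) (ltW (c_gt0 k))).
  apply: (@lt_le_trans _ _ (m N k)%:R).
    by have := Bx_lt k; rewrite -(ltr_int R) intr_norm.
  by rewrite lerBrDr -natrD (le_trans _ tr_le) // ler_nat subnK // ltnW // -subn_gt0.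
have Ay_lt k : `|(A *m y) k 0| < c k - N%:R^-1 * K%:R + N%:R^-1 * X.
  rewrite -[(A *m y) k 0](subrK (N%:R^-1 * ((B N *m x) k 0)%:~R)) addrC.
  apply: le_lt_trans (ler_normD _ _) _; apply: ltr_leD => //.
  by rewrite normrM ger0_norm ?invr_ge0 ?ler0n.
(* From x = A^-1 (A x) and the previous bound, X <= S + (T / N) X with T / N < 1 / 2. *)
have X_le : X <= 2 * S.
  have X_le1 : X <= S + T * (N%:R^-1 * X).
    rewrite /S /T mulr_suml -big_split; apply: ler_sum => j _ /=.
    rewrite mulr_suml -big_split /= -[y](mulKmx uA) mxE.
    apply: le_trans (ler_norm_sum _ _ _) _; apply: ler_sum => k _ /=.
    rewrite normrM -mulrDr ler_wpM2l // (le_trans (ltW (Ay_lt k))) // lerD2r.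
    by rewrite gerBl mulr_ge0 ?invr_ge0.
  have TX_le : 2 * (T * (N%:R^-1 * X)) <= X.
    rewrite !mulrA ler_piMl // ler_pdivrMr // mul1r ltW //.
  lra.
apply: lt_trans (Ay_lt i) _; rewrite -addrA gtrDl addrC subr_lt0 ltr_pM2l ?invr_gt0 //.
exact: le_lt_trans K_gt.
Qed.

End RealLinearForms.

(** * Embeddings of a number field *)

Lemma rmorphism_of_ext (K L : fieldType) (f : K -> L) :
  zmod_morphism f -> monoid_morphism f -> exists s : {rmorphism K -> L}, s =1 f.
Proof.
move=> fB fM.
pose s : {rmorphism K -> L} := HB.pack f
  (GRing.isZmodMorphism.Build K L f fB) (GRing.isMonoidMorphism.Build K L f fM).
by exists s.
Qed.

Lemma rmorph_horner_in_alg (K : fieldExtType rat) (L : numFieldType)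
    (s : {rmorphism K -> L}) (g : {poly rat}) (x : K) :
  s (map_poly (in_alg K) g).[x] = (map_poly ratr g).[s x].
Proof.
rewrite -horner_map -map_poly_comp; congr (_.[_]).
by apply: eq_map_poly => a /=; rewrite -(fmorph_eq_rat (s \o in_alg K)).
Qed.

Lemma number_field_separable (K : fieldExtType rat) (x : K) :
  separable_element 1 x.
Proof.
by apply: pcharf0_separable => q; rewrite pchar_lalg; apply: pchar_num.
Qed.

Section Primitive.
Variables (K : fieldExtType rat) (t : K).
Hypothesis gen_t : <<1; t>>%VS = fullv.

Lemma primitive_poly (x : K) : exists g, x == (map_poly (in_alg K) g).[t].
Proof.
by have /Fadjoin1_polyP[g ->] : x \in <<1; t>>%VS; [rewrite gen_t memvf | exists g].
Qed.

Lemma primitive_minPoly : exists p : {poly rat},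
  [/\ minPoly 1 t = map_poly (in_alg K) p, p \is monic, separable_poly p
    & size p = (\dim {:K}).+1].
Proof.
have /polyOver1P[p def_p] := minPolyOver 1 t.
exists p; split=> //.
- by have := monic_minPoly 1 t; rewrite def_p map_monic.
- rewrite -(separable_map (in_alg K)) -def_p.
  exact: number_field_separable.
- rewrite -(size_map_poly (in_alg K)) -def_p size_minPoly.
  by rewrite adjoin_degreeE gen_t dimv1 divn1.
Qed.

(** The embedding sends g(t) to g(z).  It is well defined because a rational
    polynomial vanishing at t is a multiple of the minimal polynomial p, hence
    vanishes at z; additivity and multiplicativity follow from the same fact. *)
Lemma root_embedding (L : numFieldType) (p : {poly rat}) (z : L) :
    minPoly 1 t = map_poly (in_alg K) p -> root (map_poly ratr p) z ->
  exists s : {rmorphism K -> L}, s t = z.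
Proof.
move=> def_p /rootP pz0; pose g x := xchoose (primitive_poly x).
have gK x : (map_poly (in_alg K) (g x)).[t] = x.
  by apply/esym/eqP; apply: xchooseP (primitive_poly x).
have ev0 h : (map_poly (in_alg K) h).[t] = 0 -> (map_poly ratr h).[z] = 0.
  move/rootP/(minPoly_dvdp (alg_polyOver 1 h)).
  rewrite def_p dvdp_map => /dvdpP[q ->].
  by rewrite rmorphM hornerM /= pz0 mulr0.
have evE x h : (map_poly (in_alg K) h).[t] = x ->
    (map_poly ratr (g x)).[z] = (map_poly ratr h).[z].
  move=> hx; apply/eqP; rewrite -subr_eq0 -hornerN -hornerD -rmorphB /=.
  by rewrite ev0 // rmorphB hornerD hornerN /= hx gK subrr.
pose f x := (map_poly ratr (g x)).[z].
have fE x h : (map_poly (in_alg K) h).[t] = x -> f x = (map_poly ratr h).[z].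
  exact: evE.
have [||s sE] := @rmorphism_of_ext K L f.
- move=> x y; rewrite -hornerN -hornerD -rmorphB; apply: evE.
  by rewrite rmorphB hornerD hornerN !gK.
- split=> [|x y]; first by rewrite (fE _ 1) ?rmorph1 ?hornerC.
  by rewrite -hornerM -rmorphM; apply: evE; rewrite rmorphM hornerM !gK.
by exists s; rewrite sE (fE _ 'X) ?map_polyX ?hornerX.
Qed.

End Primitive.

(** A family of embeddings told apart by their values at a single element: this
    is the form in which distinctness feeds a Vandermonde determinant. *)
Definition separating (K : fieldExtType rat) (L : numFieldType) n
  (s : 'I_n -> {rmorphism K -> L}) := exists t, injective (fun j => s j t).

(** For a primitive element t, an embedding is determined by the image of t,
    which can be any root of the minimal polynomial of t.  There are n such
    roots, distinct because the characteristic is zero. *)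
Lemma all_embeddings (K : fieldExtType rat) (L : numClosedFieldType) :
  exists s : 'I_(\dim {:K}) -> {rmorphism K -> L},
    separating s /\ forall u : {rmorphism K -> L}, exists j, u =1 s j.
Proof.
pose t := separable_generator 1 {:K}.
have gen_t : <<1; t>>%VS = fullv.
  rewrite -eq_adjoin_separable_generator ?sub1v //.
  by apply/separableP => y _; apply: number_field_separable.
have [p [def_p mon_p sep_p size_p]] := primitive_minPoly gen_t.
have [r def_r] := closed_field_poly_normal (map_poly ratr p : {poly L}).
have {}def_r : map_poly ratr p = \prod_(z <- r) ('X - z%:P) :> {poly L}.
  by rewrite {1}def_r lead_coef_map (monicP mon_p) rmorph1 scale1r.
have uniq_r : uniq r.
  by rewrite -separable_prod_XsubC -def_r separable_map.
have size_r : size r = \dim {:K}.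
  by apply: succn_inj; rewrite -size_p -(size_map_poly (@ratr L)) def_r size_prod_XsubC.
have root_r z : root (map_poly ratr p : {poly L}) z = (z \in r).
  by rewrite def_r root_prod_XsubC.
have emb (j : 'I_(\dim {:K})) : exists s : {rmorphism K -> L}, s t = r`_j.
  by apply: (root_embedding gen_t def_p); rewrite root_r mem_nth ?size_r.
have [s sE] := choice emb.
exists s; split.
  exists t => i j; rewrite !sE => /eqP.
  by rewrite nth_uniq ?size_r // => /eqP/val_inj.
move=> u; have : root (map_poly ratr p) (u t).
  by rewrite /root -rmorph_horner_in_alg -def_p minPolyxx rmorph0.
rewrite root_r => /(nthP 0)[j]; rewrite size_r => lt_j def_ut.
exists (Ordinal lt_j) => x; have /eqP := xchooseP (primitive_poly gen_t x).
by move=> ->; rewrite !rmorph_horner_in_alg sE def_ut.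
Qed.

(** * Norm, trace and discriminant through the embeddings *)

Section EmbeddingMatrix.
Variables (K : fieldExtType rat) (L : numFieldType).
Local Notation n := (\dim {:K}).
Implicit Types (w : n.-tuple K).

Lemma rmorph_scale_rat (u : {rmorphism K -> L}) (a : rat) (x : K) :
  u (a *: x) = ratr a * u x.
Proof.
by rewrite -mulr_algl rmorphM /= -(fmorph_eq_rat (u \o in_alg K)).
Qed.

Variable s : 'I_n -> {rmorphism K -> L}.
Hypothesis sep_s : separating s.

Definition embedding_mx w : 'M[L]_n := \matrix_(i, j) s j (tnth w i).

(** With t separating the embeddings, the Vandermonde matrix of the s_j t is
    invertible; it is the product of the coordinate matrix of the powers of t
    with the embedding matrix, which is therefore invertible too. *)
Lemma embedding_mx_unit w : basis_of {:K} w -> embedding_mx w \in unitmx.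
Proof.
move=> w_basis; have [t inj_t] := sep_s.
pose P : 'M[L]_n := \matrix_(i, k) ratr (coord w k (t ^+ i)).
have VP : Vandermonde n (\row_j s j t) = P *m embedding_mx w.
  apply/matrixP=> i j; rewrite !mxE -rmorphXn /=.
  rewrite [t ^+ i in LHS](coord_basis w_basis) ?memvf // rmorph_sum.
  apply: eq_bigr => k _; rewrite !mxE /= -rmorph_scale_rat.
  by rewrite (tnth_nth 0).
have : Vandermonde n (\row_j s j t) \in unitmx.
  rewrite unitmxE unitfE det_Vandermonde; apply/prodf_neq0 => i _.
  apply/prodf_neq0 => j lt_ij; rewrite !mxE subr_eq0 (inj_eq inj_t).
  by apply: contraTneq lt_ij => ->; rewrite ltnn.
by rewrite VP unitmx_mul => /andP[].
Qed.

(** The eigenvectors of multiplication by a are the columns of the embedding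
    matrix, whatever a is. *)
Lemma mul_mx_embedding (a : K) :
  map_mx ratr (mul_mx a) *m embedding_mx (vbasis {:K}) =
  embedding_mx (vbasis {:K}) *m diag_mx (\row_j s j a).
Proof.
apply/matrixP=> i j; rewrite mul_mx_diag !mxE -rmorphM /=.
rewrite [X in s j X](coord_basis (vbasisP {:K}) (memvf _)) rmorph_sum.
apply: eq_bigr => k _; rewrite !mxE rmorph_scale_rat (tnth_nth 0); congr (ratr _ * _).
by rewrite /= passmx.vecof_delta lfunE /= (tnth_nth 0).
Qed.

Lemma fnorm_embeddings (a : K) : ratr (fnorm a) = \prod_j s j a.
Proof.
have uV := embedding_mx_unit (vbasisP {:K}).
have := congr1 determinant (mul_mx_embedding a).
rewrite !det_mulmx mulrC => /mulrI; rewrite -unitmxE => /(_ uV).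
by rewrite det_map_mx det_diag => ->; apply: eq_bigr => j _; rewrite mxE.
Qed.

Lemma ftrace_embeddings (a : K) : ratr (ftrace a) = \sum_j s j a.
Proof.
have uV := embedding_mx_unit (vbasisP {:K}).
have := congr1 (fun M => \tr (M *m invmx (embedding_mx (vbasis {:K}))))
  (mul_mx_embedding a).
rewrite mulmxK // mxtrace_mulC mulKmx // trace_map_mx mxtrace_diag => ->.
by apply: eq_bigr => j _; rewrite mxE.
Qed.

(** The discriminant of an arbitrary tuple: [disc K] is its value at
    [integral_basis K]. *)
Definition tuple_disc w : rat :=
  \det (\matrix_(i < n, j < n) ftrace (tnth w i * tnth w j)).

(** The trace matrix of w is W W^T, where W is the embedding matrix. *)
Lemma tuple_disc_embeddings w : ratr (tuple_disc w) = \det (embedding_mx w) ^+ 2.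
Proof.
rewrite -det_map_mx expr2 -[X in _ = _ * X]det_tr -det_mulmx; congr (\det _).
apply/matrixP=> i j; rewrite !mxE /= ftrace_embeddings.
by apply: eq_bigr => k _; rewrite !mxE rmorphM.
Qed.

End EmbeddingMatrix.

(** * Existence of an integral basis *)

Section IntegralBasis.
Variable K : fieldExtType rat.
Local Notation n := (\dim {:K}).
Implicit Types (x y : K) (w : n.-tuple K).

Lemma alg_integer_int (m : int) : alg_integer (m%:~R : K).
Proof. exact: (integral_id (intr : {rmorphism int -> K})). Qed.

Lemma alg_integerD x y : alg_integer x -> alg_integer y -> alg_integer (x + y).
Proof. exact: (@integral_add _ _ (intr : {rmorphism int -> K})). Qed.

Lemma alg_integerM x y : alg_integer x -> alg_integer y -> alg_integer (x * y).
Proof. exact: (@integral_mul _ _ (intr : {rmorphism int -> K})). Qed.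

Lemma alg_integer_comb m (c : 'I_m -> int) (v : 'I_m -> K) :
  (forall i, alg_integer (v i)) -> alg_integer (\sum_i (c i)%:~R * v i).
Proof.
move=> v_int; elim/big_ind: _ => [||i _].
- exact: (alg_integer_int 0).
- exact: alg_integerD.
- by apply: alg_integerM => //; apply: alg_integer_int.
Qed.

(** If q is an integer polynomial of degree d and leading coefficient a that
    vanishes at x, then a^(d-1) q(X / a) is a monic integer polynomial that
    vanishes at a x. *)
Lemma alg_integer_multiple x :
  exists2 a : int, a != 0 & alg_integer (a%:~R * x).
Proof.
have /polyOver1P[p def_p] := minPolyOver 1 x.
have mon_p : p \is monic by have := monic_minPoly 1 x; rewrite def_p map_monic.
have [q [a a_neq0 pE]] := rat_poly_scale p.
have qE : map_poly intr q = a%:~R *: p by rewrite pE scalerA mulfV ?intr_eq0 // scale1r.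
exists a => //; pose d := (size q).-1.
have lead_q : q`_d = a.
  apply: (@intr_inj rat); rewrite -lead_coefE -lead_coef_map_inj //; last exact: intr_inj.
  by rewrite qE lead_coefZ (monicP mon_p) mulr1.
have size_q : size q = d.+1.
  by rewrite prednK // lt0n size_poly_eq0; apply: contraNneq a_neq0 => q0;
    rewrite -lead_q q0 coef0.
have qx0 : (map_poly intr q).[x] = 0 :> K.
  have -> : map_poly intr q = map_poly (in_alg K) (map_poly intr q).
    by rewrite -map_poly_comp; apply: eq_map_poly => m;
      exact/esym/(rmorph_int (in_alg K)).
  by rewrite qE linearZ /= hornerZ -def_p minPolyxx mulr0.
have d_gt0 : (0 < d)%N.
  rewrite /d -size_rat_int_poly qE size_scale ?intr_eq0 //.
  by rewrite -(size_map_poly (in_alg K)) -def_p size_minPoly.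
pose Q := \poly_(i < d.+1) (if i == d then 1 else q`_i * a ^+ (d.-1 - i)).
exists Q; first by rewrite monicE lead_coef_poly ?eqxx ?oner_eq0.
have -> : root (map_poly intr Q) (a%:~R * x) =
    (a%:~R ^+ d.-1 * (map_poly intr q).[x] == 0).
  rewrite /root; congr (_ == 0).
  rewrite (@horner_coef_wide _ d.+1) ?(leq_trans (size_poly _ _)) ?size_poly //.
  rewrite (@horner_coef_wide _ d.+1) ?(leq_trans (size_poly _ _)) ?size_q //.
  rewrite mulr_sumr; apply: eq_bigr => [[i lt_i]] _ /=.
  rewrite !coef_map /= coef_poly lt_i exprMn; case: eqP => [-> | /eqP neq_id].
    by rewrite mul1r mulrA lead_q -exprSr prednK.
  have le_id : (i <= d.-1)%N by rewrite -ltnS prednK // ltn_neqAle neq_id -ltnS.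
  rewrite rmorphM rmorphXn /= [in RHS]mulrA [_ ^+ d.-1 * _]mulrC -[in RHS](subnK le_id).
  by rewrite exprD !mulrA.
by rewrite qx0 mulr0.
Qed.

(** Traces and discriminants are rational; their properties are verified after
    mapping them to algC, where they are expressed through conjugates. *)
Lemma algC_embeddings : exists s : 'I_n -> {rmorphism K -> algC}, separating s.
Proof. by have [s [sep_s _]] := all_embeddings K algC; exists s. Qed.

(** The trace is rational, and it is an algebraic integer as the sum of the
    conjugates. *)
Lemma ftrace_alg_integer x : alg_integer x -> ftrace x \is a Num.int.
Proof.
move=> x_int; have [s sep_s] := algC_embeddings.
have : ratr (ftrace x) \in (Num.int : {pred algC}).
  apply: Cint_rat_Aint; first exact: Crat_rat.
  rewrite (ftrace_embeddings sep_s); apply: rpred_sum => j _.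
  have [p mon_p px0] := x_int.
  apply: (@root_monic_Aint (map_poly intr p)); last 2 first.
  - exact: monic_map.
  - by apply/polyOverP=> i; rewrite coef_map /= rpred_int.
  have : root (map_poly (s j) (map_poly intr p)) (s j x) by rewrite fmorph_root.
  by rewrite -map_poly_comp (eq_map_poly (fun m => rmorph_int (s j) m)).
case/intrP=> m; rewrite -(ratr_int algC) => /fmorph_inj ->.
exact: intr_int.
Qed.

Lemma tuple_disc_int w :
  (forall i, alg_integer (tnth w i)) -> tuple_disc w \is a Num.int.
Proof.
move=> w_int; apply: rpred_sum => p _; rewrite rpredMsign; apply: rpred_prod => i _.
by rewrite mxE ftrace_alg_integer //; apply: alg_integerM.
Qed.

(** A rational relation between the entries of w is a relation between the rows
    of the embedding matrix, whose determinant squared is the discriminant. *)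
Lemma basis_tuple_disc w : basis_of {:K} w = (tuple_disc w != 0).
Proof.
have [s sep_s] := algC_embeddings.
have -> : (tuple_disc w != 0) = (embedding_mx s w \in unitmx).
  rewrite -(fmorph_eq0 (@ratr algC)) /= (tuple_disc_embeddings sep_s).
  by rewrite expf_eq0 /= unitmxE unitfE.
apply/idP/idP; first exact: embedding_mx_unit.
move=> uW; rewrite basisEfree size_tuple leqnn subvf !andbT.
apply/freeP=> c c0 i; apply/eqP; rewrite -(fmorph_eq0 (@ratr algC)) /=.
have /rowP/(_ i) : (\row_i ratr (c i) : 'rV[algC]_n) = 0.
  apply: (can_inj (mulmxK uW)); rewrite mul0mx; apply/rowP=> j.
  rewrite !mxE -[RHS](rmorph0 (s j)) -[in RHS]c0 rmorph_sum; apply: eq_bigr => k _.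
  by rewrite !mxE /= rmorph_scale_rat (tnth_nth 0).
by rewrite !mxE => ->.
Qed.

Lemma tuple_disc_change (P : 'M[rat]_n) w w' :
  (forall i, tnth w' i = \sum_k P i k *: tnth w k) ->
  tuple_disc w' = \det P ^+ 2 * tuple_disc w.
Proof.
move=> w'E; have [s sep_s] := algC_embeddings.
apply: (fmorph_inj (@ratr algC)); rewrite rmorphM rmorphXn /=.
rewrite !(tuple_disc_embeddings sep_s) -exprMn -det_map_mx -det_mulmx.
congr (\det _ ^+ 2); apply/matrixP=> i j; rewrite !mxE w'E rmorph_sum.
by apply: eq_bigr => k _; rewrite !mxE /= rmorph_scale_rat.
Qed.

Lemma integer_basis_exists :
  exists2 w : n.-tuple K, (forall i, alg_integer (tnth w i)) & basis_of {:K} w.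
Proof.
pose b := vbasis {:K}.
have /choice[a aP] : forall i, exists a : int,
    a != 0 /\ alg_integer (a%:~R * tnth b i).
  by move=> i; have [a] := alg_integer_multiple (tnth b i); exists a.
exists [tuple (a i)%:~R * tnth b i | i < n].
  by move=> i; rewrite tnth_mktuple; case: (aP i).
rewrite basis_tuple_disc (@tuple_disc_change (diag_mx (\row_i (a i)%:~R)) b).
  rewrite mulf_neq0 ?expf_neq0 -?basis_tuple_disc ?vbasisP // det_diag.
  by apply/prodf_neq0=> i _; rewrite mxE intr_eq0; case: (aP i).
move=> i; rewrite tnth_mktuple (bigD1 i) //= big1 => [|k /negPf neq_ki].
  by rewrite addr0 !mxE eqxx mulr1n scaler_int mulrzl.
by rewrite !mxE eq_sym neq_ki mulr0n scale0r.
Qed.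

Lemma det_replace_row m (r : 'rV[rat]_m) (i0 : 'I_m) :
  \det (\matrix_(i, k) (if i == i0 then r 0 k else (i == k)%:R)) = r 0 i0.
Proof.
rewrite (expand_det_col _ i0) (bigD1 i0) //= big1 => [|i /negPf neq_i]; last first.
  by rewrite mxE neq_i mul0r.
rewrite mxE eqxx addr0 /cofactor addnn -signr_odd odd_double mul1r.
rewrite (_ : row' _ _ = 1%:M) ?det1 ?mulr1 //.
apply/matrixP=> i j; rewrite !mxE eq_sym (negPf (neq_lift _ _)).
by rewrite (inj_eq lift_inj).
Qed.

(** Among the bases made of integers choose w with |tuple_disc w| least.  If an
    integer x had a coordinate q i outside Z, then replacing the i-th vector
    of w by x - floor (q i) w_i would give another basis of integers, whose
    discriminant is smaller by the factor (q i - floor (q i))^2 in ]0, 1[. *)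
Lemma integral_basis_exists : exists w, is_integral_basis w.
Proof.
pose good k := `[< exists w : n.-tuple K, [/\ forall i, alg_integer (tnth w i),
  basis_of {:K} w & `|tuple_disc w| = k%:R] >].
have good_disc w : (forall i, alg_integer (tnth w i)) -> basis_of {:K} w ->
    exists2 k, good k & `|tuple_disc w| = k%:R.
  move=> w_int w_basis; have /intrP[m def_m] := tuple_disc_int w_int.
  have absE : `|tuple_disc w| = `|m|%N%:R by rewrite def_m -intr_norm natr_absz.
  by exists `|m|%N => //; apply/asboolP; exists w.
have ex_good : exists k, good k.
  by have [w /good_disc + /[dup] wb] := integer_basis_exists;
    move=> /[apply] -[k gk _]; exists k.
have [m /asboolP[w [w_int w_basis disc_w]] min_m] := ex_minnP ex_good.
exists w; split=> // x; split=> [x_int | [c ->]]; last exact: alg_integer_comb.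
pose q i := coord w i x.
have xE : x = \sum_i q i *: tnth w i.
  rewrite {1}(coord_basis w_basis (memvf x)); apply: eq_bigr => i _.
  by rewrite (tnth_nth 0).
suff q_int i : q i \is a Num.int.
  exists (fun i => Num.floor (q i)); rewrite {1}xE; apply: eq_bigr => i _.
  by rewrite -{1}(floorK (q_int i)) scaler_int mulrzl.
apply: contraT => q_nint; pose f := q i - (Num.floor (q i))%:~R.
pose y := x - (Num.floor (q i))%:~R * tnth w i.
pose w' := [tuple if k == i then y else tnth w k | k < n].
(* The coordinates of y on w. *)
pose r : 'rV[rat]_n := \row_k (q k - (Num.floor (q i))%:~R *+ (k == i)).
have disc_w' : tuple_disc w' = f ^+ 2 * tuple_disc w.
  have -> : f = r 0 i by rewrite mxE eqxx.
  rewrite -det_replace_row; apply: tuple_disc_change => j; rewrite tnth_mktuple.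
  case: (eqVneq j i) => [-> | neq_ji]; last first.
    rewrite (bigD1 j) //= big1 => [|k /negPf neq_kj].
      by rewrite mxE (negPf neq_ji) eqxx scale1r addr0.
    by rewrite mxE (negPf neq_ji) eq_sym neq_kj scale0r.
  rewrite /y {1}xE (bigD1 i) //= [RHS](bigD1 i) //= !mxE !eqxx mulr1n.
  rewrite scalerBl scaler_int mulrzl addrAC; congr (_ + _).
  by apply: eq_bigr => k /negPf neq_ki; rewrite !mxE eqxx neq_ki mulr0n subr0.
have f_gt0 : 0 < f.
  rewrite subr_gt0 lt_neqAle floor_le andbT -intrEfloor //.
have f_lt1 : f < 1 by rewrite ltrBlDl -[1]/(1%:~R) -intrD floorD1_gt.
have w'_int j : alg_integer (tnth w' j).
  rewrite tnth_mktuple; case: eqP => _ //; rewrite /y -mulNr -rmorphN.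
  by apply: alg_integerD => //; apply: alg_integerM => //; apply: alg_integer_int.
have disc_neq0 : tuple_disc w != 0 by rewrite -basis_tuple_disc.
have w'_basis : basis_of {:K} w'.
  by rewrite basis_tuple_disc disc_w' mulf_neq0 // expf_neq0 // gt_eqF.
have [k' good_k' disc_k'] := good_disc w' w'_int w'_basis.
have := min_m k' good_k'; rewrite -(ler_nat rat) -disc_k' -disc_w disc_w' normrM.
rewrite leNgt => /negP[]; rewrite gtr_pMl ?normr_gt0 // ger0_norm ?sqr_ge0 //.
by rewrite expr_lt1 // ltW.
Qed.

End IntegralBasis.

(** * Totally positive integers of large norm *)

(** Totally real means that the embeddings into R[i] have imaginary part zero;
    their real parts are then ring morphisms into R. *)
Lemma real_embeddings (R : realType) (K : fieldExtType rat) :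
  totally_real R K ->
  exists s : 'I_(\dim {:K}) -> {rmorphism K -> R},
    separating s /\ forall u : {rmorphism K -> R}, exists j, u =1 s j.
Proof.
move=> K_real; have [s [[t inj_t] all_s]] := all_embeddings K R[i].
have sE j x : s j x = (complex.Re (s j x))%:C%C.
  by have := K_real (s j) x; case: (s j x) => a b /= ->.
have /choice[sR sRE] j : exists u : {rmorphism K -> R}, forall x, (u x)%:C%C = s j x.
  have [||u uE] := @rmorphism_of_ext K R (fun x => complex.Re (s j x)).
  - by move=> x y; rewrite rmorphB; case: (s j x) (s j y) => [a b] [].
  - split=> [|x y]; first by rewrite rmorph1.
    by apply: complexI; rewrite [RHS]rmorphM -sE rmorphM; congr (_ * _); apply: sE.
  by exists u => x; rewrite uE -sE.
exists sR; split.
  by exists t => i j /= eq_ij; apply: inj_t; rewrite /= -!sRE eq_ij.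
move=> u; have [j uE] := all_s (real_complex R \o u); exists j => x.
by apply: complexI; rewrite sRE -uE.
Qed.

Theorem theorem5 (R : realType) (K : fieldExtType rat)
    (K_real : totally_real R K) (alpha : K) (alpha_tp : tp_integer R alpha)
    (alpha_norm : disc K < fnorm alpha) :
  (exists beta : K,
     [/\ alg_integer beta, beta != 0 & tot_gt R alpha (beta ^+ 2)])
  /\ ~ indecomposable R alpha.
Proof.
suff [b [b_int b_neq0 gt_ab]] : exists beta : K,
    [/\ alg_integer beta, beta != 0 & tot_gt R alpha (beta ^+ 2)].
  split; first by exists b.
  move=> [_ []]; exists (b ^+ 2); split=> //; split; first exact: alg_integerM.
  by move=> u; rewrite rmorphXn exprn_even_gt0 // fmorph_eq0.
have [s [sep_s all_s]] := real_embeddings K_real.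
have [w_basis w_int] : is_integral_basis (integral_basis K).
  exact: xgetPex (integral_basis_exists K).
set w := integral_basis K in w_basis w_int.
pose W := embedding_mx s w.
have uW : W \in unitmx by apply: embedding_mx_unit.
have a_gt0 j : 0 < s j alpha by case: alpha_tp.
have det_lt : `|\det W^T| < \prod_j Num.sqrt (s j alpha).
  have prod_ge0 : 0 <= \prod_j Num.sqrt (s j alpha).
    by apply: prodr_ge0 => j _; apply: sqrtr_ge0.
  rewrite det_tr -(@ltr_pXn2r _ 2) ?nnegrE // -prodrXl.
  rewrite real_normK ?num_real // -(tuple_disc_embeddings sep_s).
  under eq_bigr do rewrite sqr_sqrtr ?ltW //.
  by rewrite -fnorm_embeddings // ltr_rat.
have [||x x_neq0 x_lt] := minkowski_linear_forms _ _ det_lt.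
- by move=> j; rewrite sqrtr_gt0.
- by rewrite -unitfE -unitmxE unitmx_tr.
pose b := \sum_i (x i 0)%:~R * tnth w i; exists b.
have sbE j : s j b = (W^T *m map_mx intr x) j 0.
  rewrite mxE rmorph_sum; apply: eq_bigr => i _.
  by rewrite rmorphM rmorph_int /= !mxE mulrC.
split; first by apply/w_int; exists (fun i => x i 0).
- apply: contraNneq x_neq0 => b0.
  have : W^T *m map_mx intr x = 0.
    by apply/colP=> j; rewrite -sbE b0 rmorph0 mxE.
  rewrite -unitmx_tr in uW; move/(congr1 (mulmx (invmx W^T))).
  rewrite mulKmx // mulmx0 => /colP x0; apply/eqP/colP=> i.
  by have /eqP := x0 i; rewrite !mxE intr_eq0 => /eqP.
- move=> u; have [j uE] := all_s u; rewrite uE rmorphB rmorphXn subr_gt0.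
  rewrite -real_normK ?num_real // -[ltRHS]sqr_sqrtr ?ltW //.
  by rewrite ltr_pXn2r ?nnegrE ?sqrtr_ge0 // sbE.
Qed.
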